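(* For integers $1\le i<r$, \[ C_{i+1,r}=C_{i,r}+\sum_{k=r-i+1}^{r-1}C_{r-i+1,k}\,C_{r-k,r-k}-\sum_{k=i}^{r-1}C_{i,k}\,C_{r-k,r-k}, \] with initial values $C_{1,r}=(-1)^r/(r+1)$ for $r\ge1$.
   Context: Bernoulli numbers $B_n$ are defined by $\sum_{n\ge0}B_n x^n/n! = xe^x/(e^x-1)$. For a finite set $S\subset\mathbb Z_{\ge0}^r$, $C(S)=(-1)^r\sum_{(n_1,\dots,n_r)\in S}\prod_{j}B_{n_j}/n_j!$. For $1\le i\le r$, $C_{i,r}=C(S)$ where $S$ is the set of $(n_1,\dots,n_r)\in\mathbb Z_{\ge0}^r$ with $n_1+\dots+n_r=r$, $n_1+\dots+n_j<j$ for $1\le j<i$, and $n_{j+1}+\dots+n_r\le r-j$ for $i\le j<r$. (These are the coefficients $C^{(1,\dots,1,0,\dots,0)}$ with $i-1$ ones and $r-i$ zeros of the asymptotic expansion of the Euler–Zagier multiple zeta function at the origin.) *)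

(* Defs.v *)
From mathcomp Require Import all_boot all_order all_algebra.
Set Implicit Arguments. Unset Strict Implicit. Unset Printing Implicit Defensive.
Import Order.TTheory GRing.Theory Num.Theory.
Local Open Scope ring_scope.

(* Bernoulli numbers with sum_n B_n x^n/n! = x e^x/(e^x-1) (so B_1 = +1/2).
   Comparing coefficients of x^(m+1)/(m+1)! in x e^x = (e^x - 1) * sum B_n x^n/n!
   gives  sum_{k=0}^{m} C(m+1,k) B_k = m+1, i.e. the recursion below. *)
Fixpoint bern_seq (n : nat) : seq rat :=
  match n with
  | 0 => [:: 1]
  | n'.+1 =>
      let s := bern_seq n' in
      let m := n'.+1 in
      rcons s (((m.+1)%:R - \sum_(k < m) ('C(m.+1, k))%:R * s`_k) / (m.+1)%:R)
  end.

Definition bernoulli (n : nat) : rat := (bern_seq n)`_n.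

(* The index set S of C_{i,r}: tuples (n_1,...,n_r) (here f 0, ..., f (r-1)),
   entries automatically <= r since they sum to r. *)
Definition admissible (i r : nat) (f : {ffun 'I_r -> 'I_r.+1}) : bool :=
  [&& (\sum_(l < r) (f l : nat) == r)%N,
      [forall j : 'I_r, ((0 < j)%N && (j < i)%N) ==>
                         (\sum_(l < r | (l < j)%N) (f l : nat) < j)%N]
    & [forall j : 'I_r, (i <= j)%N ==>
                         (\sum_(l < r | (j <= l)%N) (f l : nat) <= r - j)%N]].

Arguments admissible : clear implicits.

Definition Cir (i r : nat) : rat :=
  (-1) ^+ r * \sum_(f : {ffun 'I_r -> 'I_r.+1} | admissible i r f)
                 \prod_(j < r) (bernoulli (f j) / ((f j)`!)%:R).

(* Main.v *)
(* Put [p_j = n_1 + ... + n_j - j], so that [(-1)^r C_{i,r}] is the total weight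
   of the words of length and sum [r] with [p_j < 0] for [0 < j < i] and
   [p_j >= 0] for [j >= i]; the weight is invariant under permuting the letters,
   and [p] can only decrease by 1 at a time.  Let [C*_{i,r}] be defined likewise
   with [p_j > 0] for [i <= j < r].  Then:
   - [C_{i+1,r} = C_{r+1-i,r}]: keep the first letter, which is 0, and reverse
     the rest;
   - [C*_{i,r} = C*_{r+1-i,r}]: reverse the word;
   - [C_{i,r} = C*_{i,r} + sum_(i <= k < r) C_{i,k} C_{r-k,r-k}]: cut at the last
     zero [k < r] and reverse the positive excursion after it.
   Combining the last identity for [i] and for [r+1-i] gives the recursion.
   For the initial value, paths from height [h] to 0 that stay nonnegative,
   those of length [n] being counted by [t^(n+1)], have generating function
   [T^(h+1)] with [T = t W(T)], where [W] is the generating function of the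
   [B_n / n!]; this forces [T = - log (1 - t)]. *)

Require Import Defs.
From mathcomp Require Import all_boot all_order all_algebra.
From mathcomp Require Import zify ring.
Import GRing.Theory Num.Theory.
Local Open Scope ring_scope.

Set Implicit Arguments.
Unset Strict Implicit.
Unset Printing Implicit Defensive.

(** * Words with given length and sum, and the bridge conditions *)

Definition bweight (n : nat) : rat := bernoulli n / (n`!)%:R.

Definition weight (t : seq nat) : rat := \prod_(a <- t) bweight a.

Fixpoint words (n s : nat) : seq (seq nat) :=
  if n is n'.+1 then [seq a :: u | a <- iota 0 s.+1, u <- words n' (s - a)]
  else nseq (s == 0)%N [::].

(* [p_j < 0] for [0 < j < i], [p_j >= 0] for [j >= i] and [p_j > 0] for
   [j >= m], where [p_j = n_1 + ... + n_j - j]. *)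
Definition bridge (i m : nat) (t : seq nat) : bool :=
  [forall j : 'I_(size t),
    [&& ((0 < j < i)%N ==> (sumn (take j t) < j)%N),
        ((i <= j)%N ==> (j <= sumn (take j t))%N)
      & ((m <= j)%N ==> (j < sumn (take j t))%N)]].

(** Taking [m = r] makes the strict condition vacuous, and [m = i] imposes it on the whole
    nonnegative range. The values in between interpolate, for a telescoping sum. *)
Definition bridge_sum (i m r : nat) : rat :=
  \sum_(t <- words r r | bridge i m t) weight t.

Lemma wordsS n s :
  words n.+1 s = [seq a :: u | a <- iota 0 s.+1, u <- words n (s - a)].
Proof. by []. Qed.

Lemma mem_words n s t : (t \in words n s) = (size t == n) && (sumn t == s).
Proof.
elim: n s t => [|n IH] s t.
  by rewrite mem_nseq; case: t => [|a u] //=; rewrite ?andbT; case: s.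
rewrite wordsS; apply/allpairsPdep/idP => [[a [u [ha hu ->]]]|].
  by move: hu ha; rewrite IH mem_iota /= => /andP[/eqP -> /eqP ->]; lia.
case: t => [|a u] // /andP[hn /eqP hs]; rewrite /= eqSS in hn hs; exists a, u.
by rewrite mem_iota IH hn -hs addKn eqxx; split => //; lia.
Qed.

Lemma uniq_words n s : uniq (words n s).
Proof.
elim: n s => [|n IH] s; first by rewrite /=; case: eqP.
rewrite wordsS; apply: allpairs_uniq_dep; [exact: iota_uniq | by move=> a _; exact: IH |].
by move=> [a u] [b v] _ _ /= [-> ->].
Qed.

Lemma bridgeP i m t :
  reflect (forall j, (j < size t)%N ->
             [/\ ((0 < j < i)%N -> (sumn (take j t) < j)%N),
                 ((i <= j)%N -> (j <= sumn (take j t))%N)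
               & ((m <= j)%N -> (j < sumn (take j t))%N)])
          (bridge i m t).
Proof.
apply: (iffP forallP) => [H j hj|H j].
  by have /and3P[/implyP ? /implyP ? /implyP ?] := H (Ordinal hj).
by have [? ? ?] := H j (ltn_ord j); apply/and3P; split; apply/implyP.
Qed.

Lemma sumn_take_nth t j : sumn (take j t) = (\sum_(l < j) nth 0%N t l)%N.
Proof.
elim: t j => [|a u IH] [|j]; rewrite ?big_ord0 //=.
  by rewrite big1 // => l _; rewrite nth_nil.
by rewrite big_ord_recl /= IH.
Qed.

Lemma sumn_take_drop j t : (sumn (take j t) + sumn (drop j t))%N = sumn t.
Proof. by rewrite -sumn_cat cat_take_drop. Qed.

(** * Symmetries under reversal *)

Lemma sumn_take_rev j t : (j <= size t)%N ->
  (sumn (take j (rev t)) + sumn (take (size t - j) t))%N = sumn t.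
Proof. by move=> hj; rewrite take_rev sumn_rev addnC sumn_take_drop. Qed.

Lemma sum_words_invol n s (phi : seq nat -> seq nat) (P : pred (seq nat))
    (F : seq nat -> rat) :
  {in words n s, forall t, phi t \in words n s} ->
  {in words n s, cancel phi phi} ->
  \sum_(t <- words n s | P t) F t =
  \sum_(t <- words n s | P (phi t)) F (phi t).
Proof.
move=> hphi phiK; rewrite -(big_map phi P F); apply: perm_big.
apply: uniq_perm; first exact: uniq_words.
  by rewrite map_inj_in_uniq ?uniq_words //; exact: can_in_inj phiK.
move=> t; apply/idP/mapP => [ht|[u hu ->]]; last exact: hphi.
by exists (phi t); rewrite ?phiK ?hphi.
Qed.

(** Reversal sends [p_j] to [- p_(r-j)], where [r] is the size, so it exchanges strictly negative
    and strictly positive positions. *)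
Lemma bridge_rev i t : (0 < i <= size t)%N -> sumn t = size t ->
  bridge i i (rev t) = bridge ((size t).+1 - i) ((size t).+1 - i) t.
Proof.
(* One implication suffices: [rev] and [k -> size + 1 - k] are both involutions. *)
have half u k : (0 < k <= size u)%N -> sumn u = size u ->
    bridge k k (rev u) -> bridge ((size u).+1 - k) ((size u).+1 - k) u.
  move=> hk hs /bridgeP H; apply/bridgeP => l hl.
  have [->|l0] := posnP l; first by split; lia.
  have := H (size u - l)%N; rewrite size_rev => /(_ ltac:(lia)).
  have := @sumn_take_rev (size u - l)%N u ltac:(lia).
  rewrite subKn; last lia.
  by move=> e [h1 h2 h3]; split; lia.
move=> hi hs; apply/idP/idP; first exact: half.
move=> h; have := half (rev t) ((size t).+1 - i)%N; rewrite revK size_rev sumn_rev => H.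
by have := H ltac:(lia) hs h; rewrite subKn //; lia.
Qed.

Lemma bridge_sum_rev i r : (0 < i <= r)%N ->
  bridge_sum i i r = bridge_sum (r.+1 - i) (r.+1 - i) r.
Proof.
move=> hi; rewrite /bridge_sum (@sum_words_invol r r rev).
- rewrite big_seq_cond [RHS]big_seq_cond; apply: eq_big => [t|t _].
    rewrite mem_words; apply: andb_id2l => /andP[/eqP e /eqP e2].
    by rewrite bridge_rev e.
  by apply: perm_big; rewrite perm_rev.
- by move=> t; rewrite !mem_words size_rev sumn_rev.
- by move=> t _; exact: revK.
Qed.

Definition rev_tail (t : seq nat) : seq nat :=
  if t is a :: u then a :: rev u else [::].

Lemma rev_tailK : involutive rev_tail.
Proof. by case=> [|a u] //=; rewrite revK. Qed.

Lemma size_rev_tail t : size (rev_tail t) = size t.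
Proof. by case: t => [|a u] //=; rewrite size_rev. Qed.

Lemma sumn_rev_tail t : sumn (rev_tail t) = sumn t.
Proof. by case: t => [|a u] //=; rewrite sumn_rev. Qed.

(** When the first letter is 0, reversing the rest sends [p_j] to [-1 - p_(r+1-j)] for [0 < j], with
    [r] the size. This map exchanges [p < 0] and [p >= 0]. *)
Lemma bridge_rev_tail i t : (0 < i < size t)%N -> sumn t = size t ->
  bridge i.+1 (size t) (rev_tail t) = bridge ((size t).+1 - i) (size t) t.
Proof.
have half u k : (0 < k < size u)%N -> sumn u = size u ->
    bridge k.+1 (size u) (rev_tail u) -> bridge ((size u).+1 - k) (size u) u.
  case: u => [|a u] /=; first by lia.
  move=> hk hs /bridgeP; rewrite /= size_rev => H.
  (* Position 1 must be negative since [1 < k.+1], that is, [a - 1 < 0]. *)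
  have a0 : a = 0%N by have [/(_ ltac:(lia)) + _ _] := H 1%N ltac:(lia); rewrite /= take0 /=; lia.
  rewrite {}a0 in hs H *; apply/bridgeP => -[|[|l]] /= hl; first by split; lia.
    by rewrite take0 /=; split; lia.
  have := H (size u - l)%N ltac:(lia).
  have -> : (size u - l = (size u - l.+1).+1)%N by lia.
  rewrite /=; have := @sumn_take_rev (size u - l.+1)%N u ltac:(lia).
  rewrite subKn; last lia.
  by move=> e [h1 h2 h3]; split; lia.
move=> hi hs; apply/idP/idP; first exact: half.
move=> h; have := half (rev_tail t) (size t - i)%N.
rewrite rev_tailK size_rev_tail sumn_rev_tail -subSn; last lia.
by move=> /(_ ltac:(lia) hs h); have -> : ((size t).+1 - ((size t) - i) = i.+1)%N by lia.
Qed.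

(* A negative first step must be the letter 0; keeping it and reversing the
   rest exchanges the numbers of negative and nonnegative positions. *)
Lemma bridge_sum_rev_tail i r : (0 < i < r)%N ->
  bridge_sum i.+1 r r = bridge_sum (r.+1 - i) r r.
Proof.
move=> hi; rewrite /bridge_sum (@sum_words_invol r r rev_tail).
- rewrite big_seq_cond [RHS]big_seq_cond; apply: eq_big => [t|t _].
    rewrite mem_words; apply: andb_id2l => /andP[/eqP e /eqP e2].
    by have := @bridge_rev_tail i t; rewrite e e2 => ->.
  by apply: perm_big; case: t => [|a u] //=; rewrite perm_cons perm_rev.
- by move=> t; rewrite !mem_words size_rev_tail sumn_rev_tail.
- by move=> t _; exact: rev_tailK.
Qed.

(** * Cutting a path at a zero *)

Lemma sum_words_split k l (P Q : pred (seq nat)) :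
  \sum_(t <- words (k + l) (k + l) |
        [&& sumn (take k t) == k, P (take k t) & Q (drop k t)]) weight t =
  (\sum_(u <- words k k | P u) weight u) *
  (\sum_(v <- words l l | Q v) weight v).
Proof.
rewrite big_distrlr /= -[LHS]big_filter.
pose L := [seq u ++ v | u <- [seq u <- words k k | P u], v <- [seq v <- words l l | Q v]].
rewrite (perm_big L) /=.
  rewrite big_allpairs_dep big_filter; apply: eq_bigr => u _.
  by rewrite big_filter; apply: eq_bigr => v _; rewrite /weight big_cat.
apply: uniq_perm; first by rewrite filter_uniq ?uniq_words.
  apply: allpairs_uniq; try by rewrite filter_uniq ?uniq_words.
  move=> [u v] [u' v'] /allpairsP[[a b] /= [+ + [-> ->]]] /allpairsP[[a' b'] /= [+ + [-> ->]]].
  rewrite !mem_filter !mem_words => /andP[_ /andP[/eqP e _]] _ /andP[_ /andP[/eqP e' _]] _.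
  by move=> /eqP; rewrite eqseq_cat ?e ?e' // => /andP[/eqP -> /eqP ->].
move=> t; rewrite mem_filter mem_words; apply/idP/allpairsP.
  move=> /andP[/and3P[/eqP e hP hQ] /andP[/eqP e1 /eqP e2]].
  exists (take k t, drop k t); rewrite /= !mem_filter !mem_words cat_take_drop hP hQ.
  rewrite size_takel ?size_drop ?e; last lia.
  have := sumn_take_drop k t; split=> //; lia.
move=> [[u v] /= [+ + ->]]; rewrite !mem_filter !mem_words.
move=> /andP[hP /andP[/eqP e1 /eqP e2]] /andP[hQ /andP[/eqP e3 /eqP e4]].
by rewrite take_size_cat // drop_size_cat // hP hQ size_cat sumn_cat e1 e2 e3 e4 !eqxx.
Qed.

(** A zero at [k] restarts the path: the heights of [drop k t] are those of [t] from [k] on, hence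
    positive after the start. *)
Lemma bridge_split i k t : (0 < i <= k)%N -> (k < size t)%N ->
  bridge i k.+1 t && (sumn (take k t) == k) =
  [&& sumn (take k t) == k, bridge i k (take k t) & bridge 1 1 (drop k t)].
Proof.
move=> hik hk; rewrite andbC; apply: andb_id2l => /eqP e.
have hd j : sumn (take (k + j) t) = (k + sumn (take j (drop k t)))%N.
  by rewrite takeD sumn_cat e.
apply/idP/andP => [/bridgeP H|[/bridgeP H1 /bridgeP H2]].
  split; apply/bridgeP => j.
    rewrite size_takel; last lia.
    move=> hj; rewrite take_takel ?(ltnW hj) //.
    by have [h1 h2 h3] := H j ltac:(lia); split => //; lia.
  rewrite size_drop => hj; have := H (k + j)%N ltac:(lia); rewrite hd.
  by move=> [h1 h2 h3]; split; lia.
apply/bridgeP => j hj; have [hjk|hkj] := ltnP j k.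
  have := H1 j; rewrite size_takel ?take_takel; try lia.
  by move=> /(_ hjk) [h1 h2 h3]; split => //; lia.
have := H2 (j - k)%N; rewrite size_drop => /(_ ltac:(lia)) [h1 h2 h3].
by have := hd (j - k)%N; rewrite subnKC // => ->; split; lia.
Qed.

Lemma bridge_nonzero i k t : (0 < i <= k)%N -> (k < size t)%N ->
  bridge i k.+1 t && (sumn (take k t) != k) = bridge i k t.
Proof.
move=> hik hk; apply/andP/bridgeP => [[/bridgeP H /eqP nk] j hj|H].
  have [h1 h2 h3] := H j hj; split => //; case: (eqVneq j k) => [->|]; last by lia.
  by have [_ /(_ ltac:(lia)) + _] := H k hk; lia.
split; last by have [_ _ /(_ ltac:(lia))] := H k hk; lia.
by apply/bridgeP => j hj; have [h1 h2 h3] := H j hj; split => //; lia.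
Qed.

Lemma bridge_sumS i k r : (0 < i <= k)%N -> (k < r)%N ->
  bridge_sum i k.+1 r =
  bridge_sum i k r + bridge_sum i k k * bridge_sum 1 1 (r - k).
Proof.
move=> hik hk; rewrite [LHS](bigID (fun t => sumn (take k t) == k)) /= addrC.
congr (_ + _); last rewrite -sum_words_split subnKC ?(ltnW hk) //.
  rewrite /bridge_sum big_seq_cond [RHS]big_seq_cond; apply: eq_bigl => t.
  rewrite mem_words; apply: andb_id2l => /andP[/eqP e _].
  by apply: bridge_nonzero; rewrite ?e.
rewrite big_seq_cond [RHS]big_seq_cond; apply: eq_bigl => t.
rewrite mem_words; apply: andb_id2l => /andP[/eqP e _].
by apply: bridge_split; rewrite ?e.
Qed.

(* Decomposition at the last zero before the end; the positive excursion
   following it is reversed into a negative one. *)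
Lemma bridge_sum_last_zero i r : (0 < i <= r)%N ->
  bridge_sum i r r = bridge_sum i i r +
    \sum_(i <= k < r) bridge_sum i k k * bridge_sum (r - k) (r - k) (r - k).
Proof.
move=> hi; apply/eqP; rewrite addrC -subr_eq; apply/eqP.
(* The increment from [k] to [k.+1] is the weight of the words whose last zero before the end is at
   [k]. *)
rewrite -(telescope_sumr (fun k => bridge_sum i k r)); last by case/andP: hi.
apply: eq_big_nat => k hk; rewrite bridge_sumS; try lia.
rewrite addrC addKr (@bridge_sum_rev (r - k) (r - k)); last lia.
by have -> : ((r - k).+1 - (r - k) = 1)%N by lia.
Qed.

(** * From index tuples to words *)

Lemma Cir_bridge_sum i r : Cir i r = (-1) ^+ r * bridge_sum i r r.
Proof.
rewrite /Cir /bridge_sum; congr (_ * _).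
pose enc (f : {ffun 'I_r -> 'I_r.+1}) := [seq (f j : nat) | j <- enum 'I_r].
have size_enc f : size (enc f) = r by rewrite size_map size_enum_ord.
have nth_enc f (j : 'I_r) : nth 0%N (enc f) j = f j.
  by rewrite (nth_map j) ?size_enum_ord // nth_ord_enum.
have sumn_enc f j : (j <= r)%N ->
    sumn (take j (enc f)) = (\sum_(l < r | (l < j)%N) (f l : nat))%N.
  move=> hj; rewrite sumn_take_nth (big_ord_widen _ _ hj).
  by apply: eq_bigr => l _; rewrite nth_enc.
have sumn_enc_all f : sumn (enc f) = (\sum_(l < r) (f l : nat))%N.
  rewrite -[enc f]take_size size_enc sumn_enc //; apply: eq_bigl => l.
  by rewrite ltn_ord.
pose L := [seq enc f | f : {ffun 'I_r -> 'I_r.+1} <- enum {: {ffun 'I_r -> 'I_r.+1}}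
                      & (\sum_(l < r) (f l : nat) == r)%N].
rewrite [RHS](perm_big L) /=; last first.
  apply: uniq_perm; first exact: uniq_words.
    rewrite map_inj_uniq; first by rewrite filter_uniq // enum_uniq.
    move=> f g e; apply/ffunP => j.
    by apply: val_inj; rewrite /= -!nth_enc e.
  move=> t; rewrite mem_words; apply/idP/mapP.
    move=> /andP[/eqP e1 /eqP e2].
    (* [inord] alters no letter, since each is at most the total sum [r]. *)
    have et : enc [ffun j : 'I_r => inord (nth 0%N t j)] = t.
      apply: (@eq_from_nth _ 0%N); rewrite size_enc // => j hj.
      rewrite (nth_enc _ (Ordinal hj)) ffunE /= inordK // ltnS -[X in (_ <= X)%N]e2.
      rewrite -[X in (_ <= sumn X)%N](cat_take_drop j) sumn_cat (drop_nth 0%N) ?e1 //=.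
      lia.
    exists [ffun j : 'I_r => inord (nth 0%N t j)]; last by rewrite et.
    by rewrite mem_filter mem_enum andbT -sumn_enc_all et e2.
  move=> [f +  ->]; rewrite mem_filter size_enc sumn_enc_all eqxx => /andP[-> _] //.
rewrite big_map big_filter_cond big_enum_cond /=; apply: eq_big => [f|f _]; last first.
  by rewrite /weight /enc big_map big_enum.
rewrite /admissible; apply: andb_id2l => /eqP sumf.
(* As the total is [r], a suffix sum at most [r - j] means a prefix sum at least [j]. *)
have cut j : (j <= r)%N ->
    (sumn (take j (enc f)) + \sum_(l < r | (j <= l)%N) (f l : nat) = r)%N.
  move=> hj; rewrite sumn_enc // -[RHS]sumf [RHS](bigID (fun l : 'I_r => (l < j)%N)) /=.
  by congr (_ + _)%N; apply: eq_bigl => l; rewrite -leqNgt.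
apply/andP/bridgeP => [[/forallP H1 /forallP H2] j|H].
  rewrite size_enc => hj; have /implyP := H1 (Ordinal hj); have /implyP := H2 (Ordinal hj).
  rewrite /= -sumn_enc ?(ltnW hj) //; have := cut j (ltnW hj).
  move: (sumn _) (\sum_(l < r | _) _)%N => x y exy h1 h2.
  by split=> // hij; [have := h1 hij|]; lia.
split; apply/forallP => j; have := H j; rewrite size_enc => /(_ (ltn_ord j)) [h1 h2 h3].
  by apply/implyP => hj; rewrite -sumn_enc ?(ltnW (ltn_ord j)) //; apply: h1.
apply/implyP => hj; have := cut j (ltnW (ltn_ord j)); have := h2 hj.
by move: (sumn _) (\sum_(l < r | _) _)%N => x y; lia.
Qed.

(** * Coefficients of the powers of [T = - log (1 - t)] *)

(* [logpow n h] is the coefficient of [t^n] in [(- log (1 - t))^h]; the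
   recursion is [(1 - t) (T^h)' = h T^(h-1)] for [T = - log (1 - t)]. *)
Fixpoint logpow (n h : nat) : rat :=
  if n is n'.+1
  then (n'%:R * logpow n' h + h%:R * logpow n' h.-1) / n%:R
  else (h == 0)%:R.

Lemma logpowS n h :
  n.+1%:R * logpow n.+1 h = n%:R * logpow n h + h%:R * logpow n h.-1.
Proof. by rewrite /= mulrC divfK // pnatr_eq0. Qed.

Arguments logpow : simpl never.

Lemma logpow_gt n h : (n < h)%N -> logpow n h = 0.
Proof.
elim: n h => [|n IH] [|h] // hn; apply: (@mulfI _ n.+1%:R); rewrite ?pnatr_eq0 //.
by rewrite logpowS !IH ?(ltnW hn) // !mulr0 addr0.
Qed.

Lemma logpowS0 n : logpow n.+1 0 = 0.
Proof.
elim: n => [|n IH]; first by rewrite /logpow !mul0r ?addr0 ?mul0r.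
apply: (@mulfI _ n.+2%:R); first by rewrite pnatr_eq0.
by rewrite logpowS IH mul0r !mulr0 addr0.
Qed.

Lemma logpowS1 n : logpow n.+1 1 = n.+1%:R^-1.
Proof.
elim: n => [|n IH]; first by rewrite /logpow /= mul0r add0r mulr1.
apply: (@mulfI _ n.+2%:R); first by rewrite pnatr_eq0.
by rewrite logpowS IH [_.-1]/= logpowS0 mulr0 addr0 !mulfV ?pnatr_eq0.
Qed.

(** Coefficientwise [(T^(h+1))' = (h+1) T^h / (1 - t)]; division by [1 - t] produces the partial
    sums. *)
Lemma logpow_primitive n h :
  n.+1%:R * logpow n.+1 h.+1 = h.+1%:R * \sum_(m < n.+1) logpow m h.
Proof.
elim: n => [|n IH]; first by rewrite logpowS big_ord1 mul0r add0r.
by rewrite logpowS IH [in RHS]big_ord_recr /= mulrDr.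
Qed.

(* [T^h exp T = T^h / (1 - t)] *)
Lemma logpow_exp n N h : (n <= N)%N ->
  \sum_(k < N.+1) logpow n (h + k) / (k`!)%:R = \sum_(m < n.+1) logpow m h.
Proof.
elim: n h => [|n IH] h hN.
  rewrite big_ord1 big_ord_recl addn0 /= divr1 big1 ?addr0 // => k _.
  by rewrite addnC /= mul0r.
apply: (@mulfI _ n.+1%:R); first by rewrite pnatr_eq0.
(* The exponential series is its own derivative; the top term [k = N] vanishes because [n < N]. *)
have shift : \sum_(k < N.+1) k%:R * logpow n (h + k).-1 / (k`!)%:R
             = \sum_(k < N.+1) logpow n (h + k) / (k`!)%:R.
  rewrite big_ord_recl /= !mul0r add0r [RHS]big_ord_recr /=.
  rewrite [logpow n (h + N)]logpow_gt ?mul0r ?addr0; last lia.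
  apply: eq_bigr => k _; rewrite /bump /= add1n addnS /= factS natrM.
  by field; rewrite pnatr_eq0 -lt0n fact_gt0 /= -(natrD _ 1 k) pnatr_eq0.
(* The factor [h + k] of the recursion splits as in the product rule for [T^h exp T]. *)
have -> : n.+1%:R * \sum_(k < N.+1) logpow n.+1 (h + k) / (k`!)%:R =
   n%:R * (\sum_(k < N.+1) logpow n (h + k) / (k`!)%:R)
   + h%:R * (\sum_(k < N.+1) logpow n (h + k).-1 / (k`!)%:R)
   + \sum_(k < N.+1) logpow n (h + k) / (k`!)%:R.
  rewrite -[X in _ = _ + X]shift !mulr_sumr -!big_split /=; apply: eq_bigr => k _.
  by rewrite mulrA logpowS natrD; ring.
rewrite !IH ?(ltnW hN) // [in RHS]big_ord_recr /=.
case: h {shift} => [|h].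
  by rewrite logpowS0 mul0r !addr0 -natr1; ring.
have -> : \sum_(k < N.+1) logpow n (h.+1 + k).-1 / (k`!)%:R = \sum_(m < n.+1) logpow m h.
  by rewrite -(IH h (ltnW hN)); apply: eq_bigr => k _; rewrite addSn.
rewrite [RHS]mulrDr logpow_primitive -[n.+1%:R]natr1; ring.
Qed.

(** * The Bernoulli series composed with [T] *)

Lemma size_bern_seq n : size (bern_seq n) = n.+1.
Proof. by elim: n => [|n IH] //=; rewrite size_rcons IH. Qed.

Lemma nth_bern_seq n k : (k <= n)%N -> (bern_seq n)`_k = bernoulli k.
Proof.
elim: n => [|n IH]; first by rewrite leqn0 => /eqP ->.
rewrite leq_eqVlt ltnS => /orP[/eqP -> //|hk].
by rewrite /= nth_rcons size_bern_seq ltnS hk IH.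
Qed.

Lemma bernoulli_sum m : \sum_(k < m.+1) 'C(m.+1, k)%:R * bernoulli k = m.+1%:R.
Proof.
case: m => [|m]; first by rewrite big_ord1 bin0 mul1r.
rewrite big_ord_recr /= {2}/bernoulli /= nth_rcons size_bern_seq ltnn eqxx.
under eq_bigr => k _ do rewrite -(@nth_bern_seq m k (ltn_ord k)).
by rewrite binSn mulrC divfK ?pnatr_eq0 // addrC subrK.
Qed.

(* [W (e^x - 1) = x e^x] for [W = \sum_n B_n x^n / n!] *)
Lemma bweight_conv m :
  \sum_(k < m.+1) bweight k / ((m.+1 - k)`!)%:R = ((m`!)%:R)^-1.
Proof.
have fact_neq0 n : (n`!)%:R != 0 :> rat by rewrite pnatr_eq0 -lt0n fact_gt0.
apply: (@mulfI _ (m.+1`!)%:R) => //.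
rewrite [in RHS]factS [in RHS]natrM mulfK // -[RHS](bernoulli_sum m) mulr_sumr.
apply: eq_bigr => k _; rewrite -(@bin_fact m.+1 k) ?(ltnW (ltn_ord k)) // !natrM /bweight.
by field; rewrite !fact_neq0.
Qed.

Lemma sum_shift (N j : nat) (g : nat -> rat) : (j <= N)%N ->
  (forall k, (N <= j + k)%N -> g k = 0) ->
  \sum_(k < N) g k = \sum_(m < N | (j <= m)%N) g (m - j)%N.
Proof.
move=> hj g0; rewrite -(big_mkord xpredT) -(big_mkord (leq j) (fun m => g (m - j)%N)).
rewrite (big_cat_nat (n := (N - j)%N)) ?leq_subr //= [X in _ + X]big_nat_cond.
rewrite [X in _ + X]big1 ?addr0 => [|k hk]; last by apply: g0; lia.
rewrite [RHS](big_cat_nat (n := j)) //= [X in _ = X + _]big_nat_cond.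
rewrite [X in _ = X + _]big1 ?add0r => [|k hk]; last by lia.
rewrite -{2}[j]add0n big_addn; apply: congr_big_nat => // k hk; first by lia.
by rewrite addnK.
Qed.

(* [T^h W(T) t = T^(h+1)], obtained from [T^h W(T) (e^T - 1) = T^(h+1) e^T]
   and [e^T = 1 / (1 - t)]. *)
Lemma logpow_bweight n N h : (n <= N)%N ->
  \sum_(j < N.+1) bweight j * logpow n (h + j) = logpow n.+1 h.+1.
Proof.
(* This is the identity divided by [1 - t]. The index bound [N.+2] leaves room for [k = N.+1]. *)
have partial k : (k <= N.+1)%N ->
    \sum_(m < k) \sum_(j < N.+2) bweight j * logpow m (h + j)
    = \sum_(m < k.+1) logpow m h.+1.
  move=> hk; rewrite exchange_big /= -(logpow_exp h.+1 hk).
  transitivity (\sum_(j < N.+2) \sum_(m < N.+2 | (j <= m)%N)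
                  bweight j / ((m.+1 - j)`!)%:R * logpow k (h.+1 + m)).
    apply: eq_bigr => j _; rewrite -mulr_sumr.
    have := logpow_exp (h + j) (leqW hk).
    (* Cancelling the constant term of [e^T] against the summand [m = k] leaves [e^T - 1]. *)
    rewrite big_ord_recl [in X in _ = X -> _]big_ord_recr /= addn0 divr1 addrC => /addrI <-.
    rewrite mulr_sumr.
    pose g i := bweight j * (logpow k (h + j + i.+1) / (i.+1`!)%:R).
    rewrite (@sum_shift N.+2 j g) ?(ltnW (ltn_ord j)) /g //.
      apply: eq_bigr => m hm; rewrite -subSn // mulrA mulrAC.
      by congr (_ * logpow _ _); lia.
    by move=> i hi; rewrite logpow_gt ?mul0r ?mulr0 //; lia.
  rewrite (exchange_big_dep xpredT) //=; apply: eq_bigr => m _.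
  rewrite -mulr_suml mulrC -bweight_conv; congr (_ * _).
  by rewrite (big_ord_widen N.+2 (fun j => bweight j / ((m.+1 - j)`!)%:R) (ltn_ord m)).
have widen m : (m <= N)%N ->
    \sum_(j < N.+2) bweight j * logpow m (h + j)
    = \sum_(j < N.+1) bweight j * logpow m (h + j).
  by move=> hm; rewrite big_ord_recr /= logpow_gt ?mulr0 ?addr0 //; lia.
(* Subtracting [partial n] from [partial n.+1] undoes the division by [1 - t]. *)
move=> hn; rewrite -widen //; have := partial n.+1 hn.
by rewrite !big_ord_recr /= partial ?leqW // big_ord_recr => /addrI.
Qed.

(** * Nonnegative paths and the initial value *)

(* Condition on the suffixes, equivalent for words of size and sum [r] to
   nonnegativity of all the partial sums. *)
Fixpoint suffix_small (t : seq nat) : bool :=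
  if t is a :: u then (a + sumn u <= (size u).+1)%N && suffix_small u else true.

Lemma suffix_smallP t :
  reflect (forall j, (j < size t)%N -> (sumn (drop j t) <= size t - j)%N)
          (suffix_small t).
Proof.
elim: t => [|a u IH]; first by constructor.
apply: (iffP andP) => [[h0 /IH h] [|j] //= hj|h]; first exact: h.
by split; [exact: (h 0%N) | apply/IH => j hj; exact: (h j.+1)].
Qed.

Lemma bridge_suffix_small t : sumn t = size t ->
  bridge 1 (size t) t = suffix_small t.
Proof.
move=> ht; apply/bridgeP/suffix_smallP => H j hj; have := H j hj;
  have := sumn_take_drop j t; last by split; lia.
by case: j hj => [|j] hj e [_ h _]; rewrite ?drop0 //; lia.
Qed.

Definition suffix_small_sum (n s : nat) : rat :=
  \sum_(t <- words n s | suffix_small t) weight t.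

Lemma suffix_small_sumS n s : (s <= n.+1)%N ->
  suffix_small_sum n.+1 s = \sum_(a < s.+1) bweight a * suffix_small_sum n (s - a).
Proof.
move=> hs; rewrite /suffix_small_sum wordsS big_mkcond big_allpairs_dep.
pose g a := bweight a * \sum_(t <- words n (s - a) | suffix_small t) weight t.
rewrite -(big_mkord xpredT g) /g.
rewrite /index_iota subn0; apply: eq_big_seq => a; rewrite mem_iota => ha.
rewrite mulr_sumr [RHS]big_mkcond; apply: eq_big_seq => u.
rewrite mem_words => /andP[/eqP e1 /eqP e2] /=; rewrite e1 e2 subnKC; last by lia.
by rewrite hs /weight big_cons.
Qed.

Lemma suffix_small_sum_gt n : suffix_small_sum n n.+1 = 0.
Proof.
rewrite /suffix_small_sum big_seq_cond big1 // => t; rewrite mem_words.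
case: t => [|a u] /=; first by lia.
by move=> /andP[/andP[/eqP e1 /eqP e2] /andP[]]; lia.
Qed.

(** These words are the nonnegative paths from height [n - s] to 0; removing the first letter gives
    the recursion [logpow_bweight]. The case [s = n.+1], height -1, is the boundary value 0. *)
Lemma suffix_small_sum_logpow n s : (s <= n.+1)%N ->
  suffix_small_sum n s = logpow n.+1 (n.+1 - s).
Proof.
elim: n s => [|n IH] s hs.
  case: s hs => [|[|]] // _; last by rewrite suffix_small_sum_gt subnn logpowS0.
  by rewrite logpowS1 /suffix_small_sum big_mkcond big_seq1 /weight big_nil.
move: hs; rewrite leq_eqVlt ltnS => /orP[/eqP ->|hs].
  by rewrite suffix_small_sum_gt subnn logpowS0.
rewrite suffix_small_sumS // subSn // -(@logpow_bweight n.+1 n.+1) //.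
(* The added letters [a > s] contribute 0, their exponent of [T] exceeding [n.+1]. *)
rewrite (big_ord_widen n.+2 (fun a => bweight a * suffix_small_sum n (s - a))) //.
rewrite big_mkcond; apply: eq_bigr => a _ /=; rewrite ltnS; case: leqP => ha.
  by rewrite IH; [congr (_ * logpow _ _)|]; lia.
by rewrite logpow_gt ?mulr0 //; lia.
Qed.

Lemma bridge_sum1 r : bridge_sum 1 r r = r.+1%:R^-1.
Proof.
have := suffix_small_sum_logpow (leqnSn r); rewrite subSnn logpowS1 => <-.
rewrite /bridge_sum /suffix_small_sum big_seq_cond [RHS]big_seq_cond.
apply: eq_bigl => t; rewrite mem_words; apply: andb_id2l => /andP[/eqP e /eqP e2].
by rewrite -bridge_suffix_small e.
Qed.

Theorem theorem3p2 :
  (forall i r : nat, (1 <= i)%N -> (i < r)%N ->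
     Cir i.+1 r =
       Cir i r
       + \sum_((r - i).+1 <= k < r) Cir (r - i).+1 k * Cir (r - k) (r - k)
       - \sum_(i <= k < r) Cir i k * Cir (r - k) (r - k))
  /\
  (forall r : nat, (1 <= r)%N -> Cir 1 r = (-1) ^+ r / (r.+1)%:R).
Proof.
split=> [i r i1 ir|r _]; last by rewrite Cir_bridge_sum bridge_sum1.
have sumC l : (0 < l <= r)%N ->
    \sum_(l <= k < r) Cir l k * Cir (r - k) (r - k) =
    (-1) ^+ r * (bridge_sum l r r - bridge_sum l l r).
  move=> hl; rewrite bridge_sum_last_zero // addrC addKr mulr_sumr.
  apply: eq_big_nat => k hk; rewrite !Cir_bridge_sum mulrACA -exprD subnKC //; lia.
have hi : (0 < i <= r)%N by rewrite i1 ltnW.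
rewrite (sumC (r - i).+1) ?(sumC i) //; last by lia.
(* The strict sums for [i] and [r + 1 - i] agree by reversal and cancel. *)
rewrite !Cir_bridge_sum bridge_sum_rev_tail ?i1 // (bridge_sum_rev hi).
by rewrite subSn ?(ltnW ir) //; ring.
Qed.
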